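(* Let $m\in\{3,4,5\}$ and let $n$ be an integer with $n\geq 2m+1$. Then $R(P_n,J_{2m})=n+m-1$.
   Context: All graphs are finite and simple. For graphs $G$ and $H$, the Ramsey number $R(G,H)$ is the least natural number $N$ such that for every graph $F$ on $N$ vertices, either $F$ contains $G$ as a subgraph or the complement $\overline{F}$ contains $H$ as a subgraph. $P_n$ denotes the path on $n$ vertices. For $m\geq 2$, the Jahangir graph $J_{2m}$ is the graph consisting of a cycle $C_{2m}$ together with one additional vertex adjacent to every second vertex of the cycle, i.e. to $m$ alternate vertices of $C_{2m}$ (so $J_{2m}$ has $2m+1$ vertices). *)

(* Defs.v *)
From mathcomp Require Import all_boot.
Set Implicit Arguments.
Unset Strict Implicit.
Unset Printing Implicit Defensive.

Record sgraph := SGraph {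
  vertex :> finType;
  edge : rel vertex;
  edge_sym : symmetric edge;
  edge_irrefl : irreflexive edge }.

Definition compl_edge (G : sgraph) : rel G := fun x y => (x != y) && ~~ edge x y.

Lemma compl_edge_sym G : symmetric (@compl_edge G).
Proof. by move=> x y; rewrite /compl_edge eq_sym edge_sym. Qed.

Lemma compl_edge_irrefl G : irreflexive (@compl_edge G).
Proof. by move=> x; rewrite /compl_edge eqxx. Qed.

Definition compl_graph (G : sgraph) : sgraph :=
  SGraph (@compl_edge_sym G) (@compl_edge_irrefl G).

(* Not necessarily induced: edges of [G] must be mapped to edges of [F], but
   non-adjacent vertices may become adjacent. *)
Definition contains (F G : sgraph) : Prop :=
  exists f : G -> F, injective f /\ forall x y, edge x y -> edge (f x) (f y).

Definition ramsey_arrow (G H : sgraph) (N : nat) : Prop :=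
  forall F : sgraph, #|F| = N -> contains F G \/ contains (compl_graph F) H.

(* [is_ramsey_number G H N] reads R(G, H) = N. *)
Definition is_ramsey_number (G H : sgraph) (N : nat) : Prop :=
  ramsey_arrow G H N /\ forall M, ramsey_arrow G H M -> N <= M.

Definition path_edge n : rel 'I_n := fun i j => (i.+1 == j :> nat) || (j.+1 == i :> nat).

Lemma path_edge_sym n : symmetric (@path_edge n).
Proof. by move=> i j; rewrite /path_edge orbC. Qed.

Lemma path_edge_irrefl n : irreflexive (@path_edge n).
Proof. by move=> i; rewrite /path_edge orbb eqn_leq ltnn. Qed.

Definition path_graph n : sgraph := SGraph (@path_edge_sym n) (@path_edge_irrefl n).

(* [ordS i] is the cyclic successor of [i]; the conjunct [i != j] only matters
   for [n = 1], where it removes the loop. This is the cycle C_n for [2 < n]. *)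
Definition cycle_edge n : rel 'I_n :=
  fun i j => (i != j) && ((ordS i == j) || (ordS j == i)).

Lemma cycle_edge_sym n : symmetric (@cycle_edge n).
Proof. by move=> i j; rewrite /cycle_edge eq_sym orbC. Qed.

Lemma cycle_edge_irrefl n : irreflexive (@cycle_edge n).
Proof. by move=> i; rewrite /cycle_edge eqxx. Qed.

Definition cycle_graph n : sgraph := SGraph (@cycle_edge_sym n) (@cycle_edge_irrefl n).

(* [None] is the additional vertex; it is joined to the even-numbered vertices
   of the cycle on [2 * m] vertices. Meaningful for [2 <= m]. *)
Definition jahangir_edge m : rel (option (cycle_graph (2 * m))) :=
  fun x y => match x, y with
  | Some i, Some j => edge i j
  | Some i, None | None, Some i => ~~ odd (i : 'I_(2 * m))
  | None, None => false
  end.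

Lemma jahangir_edge_sym m : symmetric (@jahangir_edge m).
Proof. by move=> [i|] [j|] //=; exact: cycle_edge_sym. Qed.

Lemma jahangir_edge_irrefl m : irreflexive (@jahangir_edge m).
Proof. by move=> [i|] //=; exact: cycle_edge_irrefl. Qed.

(* Indexed by half the length of the cycle: [jahangir_graph m] is J_{2m}. *)
Definition jahangir_graph m : sgraph :=
  SGraph (@jahangir_edge_sym m) (@jahangir_edge_irrefl m).

(* Main.v *)
Require Import Defs.
From mathcomp Require Import all_boot.
From mathcomp Require Import perm zify.
Set Implicit Arguments.
Unset Strict Implicit.
Unset Printing Implicit Defensive.

(* Lower bound: the disjoint union of K_(n-1) and K_(m-1), since J_2m is
   connected and bipartite with parts of sizes m and m+1.

   Upper bound (valid for every m >= 3): let V be a longest path of a graph, on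
   k vertices, and y, y' two vertices off V. Exchange arguments show that at
   most k/2 vertices of V are adjacent to y or y', and that equality forces two
   consecutive vertices of V among them; a vertex off V is never adjacent to two
   consecutive vertices of V. Remove longest paths one after the other and let X
   be the union of the removed ones. As soon as |X| >= 2m, put m outside vertices
   on the even positions of the cycle, an end of a removed path at the hub, and
   choose the odd vertices in X by Hall's theorem. Hall's condition can only fail
   if all pairs of outside vertices have the same neighborhood in X, with equality
   in the bound above; then two consecutive vertices x, x' of a path are both
   covered by each pair among three outside vertices, although each of the three
   is adjacent to at most one of x, x'. If |X| < 2m but adding the next path W
   would exceed 2m, fill the even positions starting with the vertices of W:
   they have few neighbors in X because W is long. *)

(* Membership hypotheses make [lia] very slow, and it takes the same [size] at two
   convertible types for different atoms. *)
Ltac arith :=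
  repeat match goal with
  | H : is_true (leq _ _) |- _ => revert H
  | H : @eq nat _ _ |- _ => revert H
  end;
  repeat match goal with
  | |- context [@size ?T ?s] =>
    let n := fresh "n" in set (n := @size T s);
    repeat match goal with
    | |- context [@size ?T' s] => change (@size T' s) with n
    end; clearbody n
  end; clear; lia.

(** * Hall's marriage theorem *)

Lemma Hall (I T : finType) (D : I -> {set T}) :
  (forall P : {set I}, #|P| <= #|\bigcup_(i in P) D i|) ->
  exists2 f : I -> T, injective f & forall i, f i \in D i.
Proof.
(* Induction on the size of the index set [Q]. The [option] supplies values off [Q], since [T] may
   be empty. *)
suff H (Q : {set I}) (E : I -> {set T}) :
    (forall P : {set I}, P \subset Q -> #|P| <= #|\bigcup_(i in P) E i|) ->
    exists2 f : I -> option T, {in Q &, injective f} &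
      forall i, i \in Q -> exists2 x, f i = Some x & x \in E i.
  move=> hall; case: (H setT D) => [P _|f finj fD]; first exact: hall.
  have fS i : exists x, (f i == Some x) && (x \in D i).
    by have [//|x -> xD] := fD i; exists x; rewrite eqxx.
  exists (fun i => xchoose (fS i)) => [i j eq_ij|i].
    apply: finj; rewrite ?inE //.
    have /andP[/eqP fi _] := xchooseP (fS i).
    by have /andP[/eqP fj _] := xchooseP (fS j); rewrite fi fj eq_ij.
  by have /andP[] := xchooseP (fS i).
have [n] := ubnP #|Q|; elim: n => // n IHn in Q E * => leQn hall.
have [->|[q qQ]] := set_0Vmem Q.
  by exists (fun=> None) => i; rewrite !inE.
(* Either some nonempty proper [P] is tight: match [P] first, then the remaining indices off its
   neighborhood [U], where Hall's condition for [R] follows from that for [R :|: P]. *)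
case: (pickP (fun P : {set I} => [&& P \proper Q, P != set0 &
                 #|\bigcup_(i in P) E i| <= #|P|])) => [P|noP].
  case/and3P=> PQ P0 tight; have sPQ := proper_sub PQ.
  have [|P' sP'P|f finj fE] := IHn P E.
  - exact: leq_trans (proper_card PQ) _.
  - by apply: hall; apply: subset_trans sPQ.
  set U := \bigcup_(i in P) E i in tight.
  have [|R sR|g ginj gE] := IHn (Q :\: P) (fun i => E i :\: U).
  - apply: leq_trans (_ : #|Q| <= _) => //.
    rewrite proper_card // properEneq subsetDl andbT.
    apply: contraNneq P0 => eQ; rewrite -subset0; apply/subsetP=> x xP.
    by move: (subsetP sPQ x xP); rewrite -eQ inE xP.
  - have dRP : [disjoint R & P].
      by apply/pred0P=> x /=; apply/negP=> /andP[/(subsetP sR)]; rewrite inE => /andP[/negP].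
    have := hall (R :|: P); rewrite subUset sPQ andbT (subset_trans sR (subsetDl _ _)).
    move/(_ isT); rewrite bigcup_setU /= -/U cardsU (disjoint_setI0 dRP) cards0 subn0.
    have -> : \bigcup_(i in R) (E i :\: U) = (\bigcup_(i in R) E i) :\: U.
      by rewrite setDE big_distrl /=; apply: eq_bigr => i _; rewrite setDE.
    rewrite cardsU cardsD.
    have := subset_leq_card (subsetIl (\bigcup_(i in R) E i) U); lia.
  exists (fun i => if i \in P then f i else g i) => [i j iQ jQ|i iQ]; last first.
    case: ifP => iP; first exact: fE.
    by have [|x -> /setDP[]] := gE i; [rewrite inE iP | exists x].
  case: ifP => iP; case: ifP => jP; first exact: finj.
  - have [x -> xE] := fE i iP; have [|z -> /setDP[_ zU]] := gE j; first by rewrite inE jP.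
    by case=> xz; case/negP: zU; apply/bigcupP; exists i; rewrite -?xz.
  - have [x -> xE] := fE j jP; have [|z -> /setDP[_ zU]] := gE i; first by rewrite inE iP.
    by case=> xz; case/negP: zU; apply/bigcupP; exists j; rewrite ?xz.
  - by apply: ginj; rewrite inE ?iP ?jP.
(* Or no [P] is tight: every nonempty proper subset has a candidate to spare, so any candidate [x]
   may be given to [q]. *)
have [x xE] : exists x, x \in E q.
  apply/set0Pn; rewrite -card_gt0; have := hall [set q].
  by rewrite cards1 big_set1 sub1set => /(_ qQ).
have [|P sP|f finj fE] := IHn (Q :\ q) (fun i => E i :\ x).
- by move: leQn; rewrite (cardsD1 q) qQ.
- have [->|P0] := eqVneq P set0; first by rewrite cards0.
  have PQ : P \proper Q.
    by apply: sub_proper_trans sP _; rewrite properD1.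
  have := noP P; rewrite PQ P0 /= => /negbT; rewrite -ltnNge => lt.
  have -> : \bigcup_(i in P) (E i :\ x) = (\bigcup_(i in P) E i) :\ x.
    by rewrite setDE big_distrl /=; apply: eq_bigr => i _; rewrite setDE.
  rewrite cardsD; have := subset_leq_card (subsetIr (\bigcup_(i in P) E i) [set x]).
  by rewrite cards1; lia.
exists (fun i => if i == q then Some x else f i) => [i j iQ jQ|i iQ]; last first.
  have [->|iq] := eqVneq i q; first by exists x.
  by have [|z -> /setD1P[]] := fE i; [rewrite !inE iq | exists z].
have [->|iq] := eqVneq i q; have [->|jq] := eqVneq j q => //.
- by have [|z -> /setD1P[zx _ []]] := fE j; [rewrite !inE jq | move/esym/eqP; rewrite (negPf zx)].
- by have [|z -> /setD1P[zx _ []]] := fE i; [rewrite !inE iq | move/eqP; rewrite (negPf zx)].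
- by apply: finj; rewrite !inE ?iq ?jq.
Qed.

(** True entries minus adjacent true pairs is the number of runs of true entries, and runs are
    separated by false entries; [f 0] and [f k] account for runs touching an end. *)
Lemma double_sum_runs (f : nat -> bool) k :
  2 * (\sum_(i < k.+1) f i) + 1 <=
    k.+1 + \sum_(i < k) (f i && f i.+1) + f 0 + f k.
Proof.
elim: k => [|k IHk]; first by rewrite big_ord1 big_ord0; case: (f 0).
rewrite big_ord_recr [\sum_(i < k.+1) (_ && _)]big_ord_recr /=.
by move: IHk; case: (f k); case: (f k.+1) => /=; lia.
Qed.

(** * Exchange arguments on a longest path [V] inside [Z] *)

Section Longest.
Variable F : sgraph.
Implicit Types (x y z u v : F) (s t w p q V : seq F).
Local Notation e := (@edge F).

Definition ispath s := uniq s && sorted e s.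

Lemma sorted_join x s t : s != [::] -> t != [::] ->
  sorted e (s ++ t) = [&& sorted e s, e (last x s) (head x t) & sorted e t].
Proof. by case: s => // y s _; case: t => // z t _; rewrite /= cat_path. Qed.

Lemma last_rev x s : last x (rev s) = head x s.
Proof. by case: s => // y s; rewrite rev_cons last_rcons. Qed.

Lemma head_rev x s t : s != [::] -> head x (rev s ++ t) = last x s.
Proof. by case/lastP: s => // s y _; rewrite rev_rcons last_rcons. Qed.

Lemma sorted_rev s : sorted e (rev s) = sorted e s.
Proof. by rewrite rev_sorted; apply: eq_sorted => x y; rewrite edge_sym. Qed.

Lemma ispath_rev s : ispath (rev s) = ispath s.
Proof. by rewrite /ispath rev_uniq sorted_rev. Qed.

Lemma ispath_suffix s t : ispath (s ++ t) -> ispath t.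
Proof.
rewrite /ispath cat_uniq => /andP[/and3P[_ _ ->]].
by case: s => // x s; rewrite /= cat_path => /andP[_ /path_sorted].
Qed.

Lemma ispath_prefix s t : ispath (s ++ t) -> ispath s.
Proof. by rewrite -ispath_rev rev_cat => /ispath_suffix; rewrite ispath_rev. Qed.

(** [u] cuts [w] into two sides; the longer one, walked away from [u], has at least half of the
    other [size w - 1] vertices, rounded up. *)
Lemma ispath_from w u : ispath w -> u \in w -> exists2 p,
  ispath (u :: p) /\ {subset u :: p <= w} & (size w)./2 <= size p.
Proof.
move=> wp /splitPr wE; case: wE wp => p1 p2 wp.
have [le12|lt21] := leqP (size p1) (size p2).
  exists p2; last by rewrite size_cat /=; arith.
  by split; [apply: ispath_suffix wp | move=> x; rewrite mem_cat orbC => ->].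
exists (rev p1); last by rewrite size_cat size_rev /=; arith.
split; last first.
  move=> x; rewrite -rev_rcons mem_rev mem_rcons !inE mem_cat !inE.
  by move=> /orP[]->; rewrite ?orbT.
by rewrite -rev_rcons ispath_rev; move: wp; rewrite -cat_rcons; apply: ispath_prefix.
Qed.

Lemma ispath_between w u v : ispath w -> u \in w -> v \in w ->
  exists2 p, ispath (u :: p) & {subset u :: p <= w} /\ last u p = v.
Proof.
move=> wp /splitPr wE; case: wE wp => p1 p2 wp vw.
have from q : ispath (u :: q) -> v \in u :: q ->
    exists2 p, ispath (u :: p) & {subset u :: p <= u :: q} /\ last u p = v.
  move=> qp /splitPl qE; case: qE qp => q1 q2 lq qp; exists q1.
    by move: qp; rewrite -cat_cons; apply: ispath_prefix.
  by split=> // x; rewrite !inE mem_cat => /orP[]->; rewrite ?orbT.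
have {vw}/orP[vp|vp] : (v \in u :: p2) || (v \in u :: rev p1).
  by move: vw; rewrite mem_cat !inE mem_rev; case: (v == u); case: (v \in p1); case: (v \in p2).
- have [p pp [sp lp]] := from p2 (ispath_suffix wp) vp.
  by exists p; rewrite // lp; split=> // x /sp; rewrite mem_cat orbC => ->.
- have rp : ispath (u :: rev p1).
    by rewrite -rev_rcons ispath_rev; move: wp; rewrite -cat_rcons; apply: ispath_prefix.
  have [p pp [sp lp]] := from _ rp vp.
  exists p; rewrite // lp; split=> // x /sp.
  by rewrite mem_cat !inE mem_rev => /orP[]->; rewrite ?orbT.
Qed.

Variables (Z : {set F}) (V : seq F).
Hypothesis Vpath : ispath V.
Hypothesis VZ : {subset V <= Z}.
Hypothesis Vmax : forall s, ispath s -> {subset s <= Z} -> size s <= size V.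

(* The next lemmas contradict maximality by exhibiting a longer path; it is a
   rearrangement of [V] and new vertices, which gives its uniqueness for free. *)
Lemma longest_perm s t :
  sorted e s -> perm_eq s t -> uniq t -> {subset t <= Z} -> size t <= size V.
Proof.
move=> ss st ut tZ; rewrite -(perm_size st); apply: Vmax.
  by rewrite /ispath (perm_uniq st) ut.
by move=> x; rewrite (perm_mem st); apply: tZ.
Qed.

Local Notation k := (size V).
Let Vu : uniq V. Proof. by case/andP: Vpath. Qed.
Let Vs : sorted e V. Proof. by case/andP: Vpath. Qed.

Lemma uniq_outside s : uniq s -> {subset s <= [predC V]} -> uniq (s ++ V).
Proof.
move=> us sV; rewrite cat_uniq us Vu andbT /=.
by apply/hasPn=> x xV; apply/negP => /sV; rewrite inE xV.
Qed.

(** The outside path could replace the [i] vertices before position [i], or the [k - i.+1] vertices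
    after it; by maximality neither exchange is a gain. *)
Lemma join_start p x0 y : ispath (y :: p) -> {subset y :: p <= Z} ->
  {subset y :: p <= [predC V]} -> forall i, i < k -> e (nth x0 V i) y ->
  (size p).+1 <= i /\ i + (size p).+1 < k.
Proof.
move=> /andP[pu ps] pZ pV i ik eiy.
have D : take i V ++ nth x0 V i :: drop i.+1 V = V by rewrite -drop_nth // cat_take_drop.
have U := uniq_outside pu pV.
have S : sorted e (take i.+1 V) /\ sorted e (drop i V).
  by rewrite take_sorted // drop_sorted.
have sub s : {subset s <= V} -> {subset (y :: p) ++ s <= Z}.
  by move=> sV x; rewrite mem_cat => /orP[/pZ|/sV/VZ].
split.
- have := @longest_perm (rev (y :: p) ++ drop i V) ((y :: p) ++ drop i V).
  rewrite size_cat size_drop /= => H; suff : (size p).+1 + (k - i) <= k by arith.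
  apply: H.
  + rewrite (sorted_join x0) ?sorted_rev ?S.2 ?ps //=.
    * by rewrite rev_cons last_rcons -nth0 nth_drop addn0 edge_sym eiy.
    * by rewrite -size_eq0 size_rev.
    * by rewrite -size_eq0 size_drop subn_eq0 -ltnNge.
  + by apply/seq.permP=> P; rewrite /= !count_cat count_rev /=; arith.
  + by move: U; rewrite -{1}(cat_take_drop i V) uniq_catCA cat_uniq => /and3P[].
  + by apply: sub => x /mem_drop.
- have := @longest_perm (take i.+1 V ++ y :: p) ((y :: p) ++ take i.+1 V).
  rewrite size_cat size_take /= => H.
  suff : (size p).+1 + (if i.+1 < k then i.+1 else k) <= k by case: ifP; arith.
  apply: H.
  + rewrite (sorted_join x0) ?S.1 ?ps ?andbT //=.
      by rewrite (take_nth x0) // last_rcons.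
    by case: (V) ik.
  + by apply/seq.permP=> P; rewrite /= !count_cat /=; arith.
  + by move: U; rewrite -{1}(cat_take_drop i.+1 V) catA cat_uniq => /and3P[].
  + by apply: sub => x /mem_take.
Qed.

(** Otherwise the whole outside path fits between two consecutive vertices of [V]. *)
Lemma insert_contra p x0 y : ispath (y :: p) -> {subset y :: p <= Z} ->
  {subset y :: p <= [predC V]} -> forall i, i.+1 < k ->
  e (nth x0 V i) y -> ~~ e (last y p) (nth x0 V i.+1).
Proof.
move=> /andP[pu ps] pZ pV i ik e1; apply/negP => e2.
have := @longest_perm (take i.+1 V ++ (y :: p) ++ drop i.+1 V) ((y :: p) ++ V).
rewrite size_cat /= => H; suff : (size p).+1 + k <= k by arith.
apply: H.
- rewrite (sorted_join x0) ?take_sorted //=; last by case: (V) ik.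
  rewrite (take_nth x0) 1?ltnW // last_rcons e1 /= cat_path [path _ _ _]ps /=.
  rewrite (drop_nth x0) //= e2 /=.
  by have := drop_sorted i.+1 Vs; rewrite (drop_nth x0).
- rewrite -{3}(cat_take_drop i.+1 V); apply/seq.permP=> P.
  by rewrite /= !count_cat /= !count_cat; arith.
- exact: (@uniq_outside (y :: p)).
- by move=> x; rewrite -cat_cons mem_cat => /orP[/pZ|/VZ].
Qed.

Lemma segment x0 i j : i <= j -> j < k -> let M := drop i (take j.+1 V) in
  [/\ M != [::], sorted e M, head x0 M = nth x0 V i & last x0 M = nth x0 V j].
Proof.
move=> ij jk M; have sM : size M = j.+1 - i by rewrite size_drop size_takel.
split; first by rewrite -size_eq0 sM; arith.
- by rewrite drop_sorted ?take_sorted.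
- by rewrite -nth0 nth_drop addn0 nth_take.
- rewrite -nth_last sM nth_drop nth_take; last arith.
  by congr nth; arith.
Qed.

(** * Exchanges that bring in two outside vertices at once *)

Section TwoVertices.
Variables (x0 y y' : F).
Hypotheses (yZ : y \in Z) (yV : y \notin V) (y'Z : y' \in Z) (y'V : y' \notin V).
Hypothesis yy' : y != y'.

Let u2 : uniq ([:: y; y'] ++ V).
Proof.
by apply: uniq_outside => [|x]; rewrite /= ?inE ?yy' // => /orP[] /eqP ->.
Qed.

Let sub2 s : {subset s <= V} -> {subset [:: y; y'] ++ s <= Z}.
Proof. by move=> sV x; rewrite !inE => /or3P[/eqP->|/eqP->|/sV/VZ]. Qed.

(* Otherwise [V_0 .. V_i, y, V_j .. V_(i+1), y', V_(j+1) ..] is longer. *)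
Lemma crossing_contra i j : i.+1 < j -> j.+1 < k ->
  e y (nth x0 V i) -> e y (nth x0 V j) -> e y' (nth x0 V i.+1) -> ~~ e y' (nth x0 V j.+1).
Proof.
move=> ij jk e1 e2 e3; apply/negP=> e4.
pose p := take i.+1 V; pose M := drop i.+1 (take j.+1 V); pose q := drop j.+1 V.
have D : p ++ M ++ q = V.
  have -> : p = take i.+1 (take j.+1 V) by rewrite take_takel //; arith.
  by rewrite catA !cat_take_drop.
have := @longest_perm (p ++ y :: rev M ++ y' :: q) ([:: y; y'] ++ V).
rewrite size_cat /= => H; suff : k.+2 <= k by arith.
have [M0 sM headM lastM] := segment x0 (ltnW ij) (ltnW jk).
have p0 : p != [::] by rewrite -size_eq0 size_takel //; arith.
apply: H => //; last exact: sub2.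
- rewrite (sorted_join x0) // take_sorted //= {1}/p (take_nth x0) ?last_rcons; last arith.
  rewrite edge_sym e1 -[path _ _ _]/(sorted e ([:: y] ++ (rev M ++ y' :: q))).
  rewrite (sorted_join x0) //=; last by case: (rev M).
  rewrite (sorted_join x0) ?sorted_rev -?size_eq0 ?size_rev ?size_eq0 //=.
  rewrite head_rev // lastM e2 sM last_rev headM edge_sym e3 /=.
  rewrite /q (drop_nth x0) //= e4 /=.
  by have := drop_sorted j.+1 Vs; rewrite (drop_nth x0).
- rewrite -D; apply/seq.permP => P.
  by rewrite /= !count_cat /= count_cat count_rev /=; arith.
Qed.

(* Otherwise [y', V_j .. V_1, y, V_(j+1) ..] is longer: it loses only [V_0]. *)
Lemma second_contra j : 0 < j -> j.+1 < k ->
  e y' (nth x0 V j) -> e y (nth x0 V j.+1) -> ~~ e y (nth x0 V 1).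
Proof.
move=> j0 jk e1 e2; apply/negP=> e3.
pose M := drop 1 (take j.+1 V); pose q := drop j.+1 V.
have D : M ++ q = drop 1 V.
  rewrite -[in RHS](cat_take_drop j.+1 V) drop_cat size_takel; last arith.
  by rewrite ltnS j0.
have := @longest_perm (y' :: rev M ++ y :: q) ([:: y; y'] ++ drop 1 V).
rewrite size_cat size_drop /= => H; suff : 2 + (k - 1) <= k by arith.
have [M0 sM headM lastM] := segment x0 j0 (ltnW jk).
apply: H.
- rewrite -[path _ _ _]/(sorted e ([:: y'] ++ (rev M ++ y :: q))).
  rewrite (sorted_join x0) //=; last by case: (rev M).
  rewrite (sorted_join x0) ?sorted_rev -?size_eq0 ?size_rev ?size_eq0 //=.
  rewrite head_rev // lastM e1 sM last_rev headM edge_sym e3 /=.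
  rewrite /q (drop_nth x0) //= e2 /=.
  by have := drop_sorted j.+1 Vs; rewrite (drop_nth x0).
- rewrite -D; apply/seq.permP => P.
  by rewrite /= !count_cat /= count_rev; arith.
- by move: u2; rewrite -{1}(cat_take_drop 1 V) uniq_catCA cat_uniq => /and3P[].
- by apply: sub2 => x /mem_drop.
Qed.

End TwoVertices.

Lemma no_consecutive_neighbors x0 y i : y \in Z -> y \notin V -> i.+1 < k ->
  e y (nth x0 V i) -> ~~ e y (nth x0 V i.+1).
Proof.
move=> yZ yV ik; rewrite edge_sym => ei.
have := @insert_contra [::] x0 y _ _ _ i ik ei; apply => //.
- by move=> x; rewrite inE => /eqP->.
- by move=> x; rewrite inE => /eqP->.
Qed.

Lemma neighbor_inner x0 y i : y \in Z -> y \notin V -> i < k ->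
  e y (nth x0 V i) -> 0 < i /\ i.+1 < k.
Proof.
move=> yZ yV ik; rewrite edge_sym => ei.
have [] // := @join_start [::] x0 y _ _ _ i ik ei; last arith.
- by move=> x; rewrite inE => /eqP->.
- by move=> x; rewrite inE => /eqP->.
Qed.

(** * Counting the vertices of [V] adjacent to outside vertices, by position *)

Lemma card_positions x0 (P : pred F) :
  #|[set x in V | P x]| = \sum_(i < k) P (nth x0 V i).
Proof.
have -> : #|[set x in V | P x]| = #|[seq x <- V | P x]|.
  by apply: eq_card => x; rewrite inE mem_filter andbC.
rewrite (card_uniqP _) ?filter_uniq // size_filter -sum1_count big_mkcond.
by rewrite (big_nth x0) big_mkord; apply: eq_bigr => i _; case: (P _).
Qed.

(** Two such positions [i < j] are excluded by [crossing_contra], unless [j = i.+1]; then [y] has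
    two consecutive neighbors. *)
Lemma sum_crossing_le1 x0 y y' : y \in Z -> y \notin V -> y' \in Z -> y' \notin V ->
  y != y' -> \sum_(i < k.-1) (e y (nth x0 V i) && e y' (nth x0 V i.+1)) <= 1.
Proof.
move=> yZ yV y'Z y'V yy'.
pose C := [set i : 'I_k.-1 | e y (nth x0 V i) && e y' (nth x0 V i.+1)].
have -> : \sum_(i < k.-1) (e y (nth x0 V i) && e y' (nth x0 V i.+1)) = #|C|.
  by rewrite -sum1_card [RHS]big_mkcond; apply: eq_bigr => i _; rewrite inE; case: (_ && _).
have wlt (i j : 'I_k.-1) : i \in C -> j \in C -> i < j -> False.
  rewrite !inE => /andP[i1 i2] /andP[j1 j2] ij; have := ltn_ord j => jk.
  have [ij1|ij1] := eqVneq i.+1 (j : nat).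
    have ik : i.+1 < k by arith.
    by have /negP := no_consecutive_neighbors yZ yV ik i1; rewrite ij1.
  have lt_ij : i.+1 < j by rewrite ltn_neqAle ij1.
  have lt_jk : j.+1 < k by arith.
  by have /negP := crossing_contra yZ yV y'Z y'V yy' lt_ij lt_jk i1 j1 i2.
apply/card_le1_eqP => i j iC jC; apply/val_inj/eqP.
by case: (ltngtP i j) => // ij; [case: (wlt _ _ iC jC ij) | case: (wlt _ _ jC iC ij)].
Qed.

(** Neither vertex alone has two consecutive neighbors, so a consecutive attached pair uses [y] at
    one position and [y'] at the other. *)
Lemma consecutive_split x0 y y' i : y \in Z -> y \notin V -> y' \in Z -> y' \notin V ->
  i.+1 < k ->
  let f i := e y (nth x0 V i) || e y' (nth x0 V i) in
  f i && f i.+1 = (e y (nth x0 V i) && e y' (nth x0 V i.+1)) ||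
                  (e y' (nth x0 V i) && e y (nth x0 V i.+1)).
Proof.
move=> yZ yV y'Z y'V ik /=.
have := no_consecutive_neighbors (x0 := x0) yZ yV ik.
have := no_consecutive_neighbors (x0 := x0) y'Z y'V ik.
by case: (e y _); case: (e y' _); case: (e y _) => //=; case: (e y' _) => //= A B;
  rewrite ?(A isT) ?(B isT).
Qed.

Lemma attached_longest y y' : y \in Z -> y \notin V -> y' \in Z -> y' \notin V ->
  y != y' -> 2 * #|[set x in V | e y x || e y' x]| <= k.
Proof.
move=> yZ yV y'Z y'V yy'; rewrite (card_positions y).
pose f i := e y (nth y V i) || e y' (nth y V i).
rewrite -[\sum_(i < _) _]/(\sum_(i < k) f i).
have f_inner i : i < k -> f i -> 0 < i /\ i.+1 < k.
  by move=> ik /orP[]; apply: neighbor_inner.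
case kE : k => [|h]; first by rewrite big_ord0.
have f0 : f 0 = false by apply/negP => /f_inner[]; rewrite ?kE.
have fh : f h = false by apply/negP => /f_inner[]; rewrite kE ?ltnn.
pose c1 := \sum_(i < h) (e y (nth y V i) && e y' (nth y V i.+1)).
pose c2 := \sum_(i < h) (e y' (nth y V i) && e y (nth y V i.+1)).
have c12 : \sum_(i < h) (f i && f i.+1) <= c1 + c2.
  rewrite -big_split; apply: leq_sum => i _; rewrite /f consecutive_split //.
    by case: (_ && _) => //=; rewrite leq_addr.
  by rewrite kE ltnS.
have c1_le : c1 <= 1 by have := sum_crossing_le1 y yZ yV y'Z y'V yy'; rewrite kE.
have c2_le : c2 <= 1.
  by have := sum_crossing_le1 y y'Z y'V yZ yV; rewrite eq_sym kE => /(_ yy').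
have R := double_sum_runs f h; rewrite f0 fh in R.
(* The ends of [V] are not attached, so at most one consecutive pair gives the bound by [R] and
   parity. Two pairs leave an excess of one, removed below. *)
have [c1_0|c1_gt0] := posnP c1; first arith.
have [c2_0|c2_gt0] := posnP c2; first arith.
(* Both crossings occur, so neither [y] nor [y'] is adjacent to the second vertex of [V]. *)
have f1 : f 1 = false.
  apply/negP => /orP[] f1.
  - move: c2_gt0; rewrite lt0n sum_nat_eq0 negb_forall => /existsP[j]; rewrite eqb0 negbK.
    case/andP=> j1 j2; have jk : j.+1 < k by rewrite kE ltnS.
    have jk' := ltnW jk.
    have [j0 _] := neighbor_inner y'Z y'V jk' j1.
    by have /negP := second_contra yZ yV y'Z y'V yy' j0 jk j1 j2.
  - move: c1_gt0; rewrite lt0n sum_nat_eq0 negb_forall => /existsP[j]; rewrite eqb0 negbK.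
    case/andP=> j1 j2; rewrite eq_sym in yy'.
    have jk : j.+1 < k by rewrite kE ltnS.
    have jk' := ltnW jk.
    have [j0 _] := neighbor_inner yZ yV jk' j1.
    by have /negP := second_contra y'Z y'V yZ yV yy' j0 jk j1 j2.
case: h => [|h] in kE fh c1 c2 c12 c1_le c2_le R c1_gt0 c2_gt0 *.
  by rewrite /c1 big_ord0 in c1_gt0.
have s1 : \sum_(i < h.+2) f i = \sum_(i < h.+1) f i.+1.
  by rewrite big_ord_recl f0; apply: eq_bigr.
have s2 : \sum_(i < h.+1) (f i && f i.+1) = \sum_(i < h) (f i.+1 && f i.+2).
  by rewrite big_ord_recl f0; apply: eq_bigr.
(* Counting from position 1, also unattached, shortens the range by one without losing an attached
   vertex. *)
have := double_sum_runs (f \o succn) h; rewrite /= f1 fh -s1 -s2.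
have := leq_trans c12 (leq_add c1_le c2_le).
by move: (\sum_(i < h.+2) f i) (\sum_(i < h.+1) (f i && f i.+1)) => s c; clear; lia.
Qed.

(** With unattached ends, isolated attached positions would number strictly less than half, so two
    of them are consecutive. *)
Lemma attached_longest_tight y y' : y \in Z -> y \notin V -> y' \in Z -> y' \notin V ->
  0 < k -> k <= 2 * #|[set x in V | e y x || e y' x]| ->
  exists x x', [/\ x \in V, x' \in V, e y x || e y' x, e y x' || e y' x' &
                 forall z, z \in Z -> z \notin V -> ~~ (e z x && e z x')].
Proof.
move=> yZ yV y'Z y'V; rewrite (card_positions y).
pose f i := e y (nth y V i) || e y' (nth y V i).
rewrite -[\sum_(i < _) _]/(\sum_(i < k) f i).
have f_inner i : i < k -> f i -> 0 < i /\ i.+1 < k.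
  by move=> ik /orP[]; apply: neighbor_inner.
case kE : k => [//|h] _ tight.
have f0 : f 0 = false by apply/negP => /f_inner[]; rewrite ?kE.
have fh : f h = false by apply/negP => /f_inner[]; rewrite kE ?ltnn.
have : 0 < \sum_(i < h) (f i && f i.+1).
  have := double_sum_runs f h; rewrite f0 fh.
  by move: tight; move: (\sum_(i < h.+1) f i) (\sum_(i < h) _) => s c; clear; lia.
rewrite lt0n sum_nat_eq0 negb_forall => /existsP[i]; rewrite eqb0 negbK => /andP[fi fi1].
have ik : i.+1 < k by rewrite kE ltnS.
exists (nth y V i), (nth y V i.+1); split; rewrite ?mem_nth ?(ltnW ik) //.
move=> z zZ zV; apply/negP => /andP[z1 z2].
by have := no_consecutive_neighbors zZ zV ik z1; rewrite z2.
Qed.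

(** Attached positions stay [p] away from both ends by [join_start], applied to the longer part of
    [w], and no two are consecutive by [insert_contra], applied to a stretch of [w]. They thus fill
    at most half, rounded up, of the [k - 2 * p] middle positions, and [2 * p] exceeds [size w]. *)
Lemma attached_path w : ispath w -> {subset w <= Z} -> {subset w <= [predC V]} ->
  2 * #|[set x in V | has (e x) w]| + size w <= k.
Proof.
move=> wp wZ wV.
have [|[x0 x0w]] : w = [::] \/ exists x, x \in w.
- by case: (w) => [|x s]; [left | right; exists x; rewrite mem_head].
- by move=> ->; rewrite eq_card0 => [|x]; rewrite ?inE ?andbF.
rewrite (card_positions x0).
pose f i := has (e (nth x0 V i)) w; pose p := (size w)./2.+1.
rewrite -[\sum_(i < _) _]/(\sum_(i < k) f i).
have f_inner i : i < k -> f i -> p <= i /\ i + p < k.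
  move=> ik /hasP[u uw eu]; have [q [qp qw] sq] := ispath_from wp uw.
  have := join_start qp (fun x xq => wZ x (qw x xq)) (fun x xq => wV x (qw x xq)) ik eu.
  by move: sq; rewrite /p; clear; lia.
have f_runs i : i.+1 < k -> f i -> ~~ f i.+1.
  move=> ik /hasP[u uw eu]; apply/hasPn => v vw.
  have [q qp [qw <-]] := ispath_between wp uw vw.
  rewrite edge_sym.
  by have := insert_contra qp (fun x xq => wZ x (qw x xq)) (fun x xq => wV x (qw x xq)) ik eu.
(* Without any attached position the bound is the maximality of [V] itself. *)
have [i fi|nof] := pickP (fun i : 'I_k => f i); last first.
  by rewrite big1 ?Vmax // => i _; rewrite nof.
have [pi ip] := f_inner _ (ltn_ord i) fi.
have [h kE] : exists h, k = p + h.+1 + p.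
  by exists (k - p - p.+1); move: pi ip; rewrite /p; clear; lia.
have out j : j < p \/ p + h.+1 <= j -> j < k -> f j = false.
  by move=> jp jk; apply/negP => /(f_inner _ jk); move: jp; rewrite kE /p; clear; lia.
have -> : \sum_(i < k) f i = \sum_(i < h.+1) f (p + i).
  rewrite -(big_mkord xpredT (fun i => nat_of_bool (f i))) (big_cat_nat (n := p)) //=; last first.
    by rewrite kE -addnA leq_addr.
  rewrite big_nat_cond big1 ?add0n => [|j /andP[/andP[_ jp] _]]; last first.
    by rewrite out //; [left | rewrite kE -addnA ltn_addr].
  rewrite (big_cat_nat (n := p + h.+1)) ?leq_addr //=; last by rewrite kE leq_addr.
  rewrite [X in _ + X]big_nat_cond [X in _ + X]big1 ?addn0; last first.
    by move=> j /andP[/andP[jp jk] _]; rewrite out //; right.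
  rewrite -[X in \sum_(X <= _ < _) _]add0n big_addn addKn big_mkord.
  by apply: eq_bigr => j _; rewrite addnC.
have c0 : \sum_(j < h) ((f \o addn p) j && (f \o addn p) j.+1) = 0.
  apply: big1 => j _; apply/eqP; rewrite eqb0 negb_and -implybE; apply/implyP.
  by rewrite /= addnS; apply: f_runs; move: (ltn_ord j); rewrite kE; clear; lia.
have := double_sum_runs (f \o addn p) h; rewrite c0 /=.
move: kE (leq_b1 (f (p + 0))) (leq_b1 (f (p + h))); rewrite /p.
by move: (\sum_(j < h.+1) _) => s; arith.
Qed.

Lemma hub_longest : 0 < k -> exists2 h, h \in V & forall y, y \in Z -> y \notin V -> ~~ e h y.
Proof.
case VE : (V) => [//|h V'] _; exists h; first exact: mem_head.
move=> y yZ yV; rewrite -VE in yV; apply/negP => ehy.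
have kP : 0 < k by rewrite VE.
have [] // := @neighbor_inner h y 0 yZ yV kP.
by rewrite VE edge_sym.
Qed.

End Longest.

(** * Unions of successively removed longest paths *)

Section Reservoir.
Variable F : sgraph.
Implicit Types (x y z : F) (X Z : {set F}) (w V : seq F).
Local Notation e := (@edge F).

Lemma longest_path_exists Z : exists V, [/\ ispath V, {subset V <= Z} &
  forall s, ispath s -> {subset s <= Z} -> size s <= size V].
Proof.
pose P n := [exists t : n.-tuple F, ispath t && all (mem Z) t].
have P0 : exists n, P n by exists 0; apply/existsP; exists [tuple].
have Pmax n : P n -> n <= #|F|.
  case/existsP=> t /andP[/andP[/card_uniqP ut _] _].
  by rewrite -(size_tuple t) -ut max_card.
case: (ex_maxnP P0 Pmax) => n /existsP[t /andP[tp /allP tZ]] nmax.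
exists t; split=> // s sp sZ; rewrite size_tuple; apply: nmax; apply/existsP.
by exists (in_tuple s); rewrite sp; apply/allP.
Qed.

Definition attached X y y' := [set x in X | e y x || e y' x].

(* The invariant of the union [X] of the longest paths removed so far. *)
Definition reservoir X := [/\
  exists2 h, h \in X & forall y, y \notin X -> ~~ e h y,
  forall y y', y \notin X -> y' \notin X -> y != y' -> 2 * #|attached X y y'| <= #|X|,
  forall y y', y \notin X -> y' \notin X -> #|X| <= 2 * #|attached X y y'| ->
    exists x x', [/\ x \in attached X y y', x' \in attached X y y' &
                   forall z, z \notin X -> ~~ (e z x && e z x')] &
  forall w, ispath w -> w != [::] -> {subset w <= [predC X]} ->
    2 * #|[set x in X | has (e x) w]| + size w <= #|X| ].

(** The case [set0] starts the process, as [set0] has no hub. The new hub comes from [V], the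
    counting bounds add up, and tightness on the union forces tightness on [X] or on [V]. *)
Lemma reservoir_longest X V : X = set0 \/ reservoir X ->
  ispath V -> V != [::] -> {subset V <= [predC X]} ->
  (forall s, ispath s -> {subset s <= [predC X]} -> size s <= size V) ->
  reservoir (X :|: [set x in V]) /\ #|X :|: [set x in V]| = #|X| + size V.
Proof.
move=> Xres Vp V0 VX Vmax.
have VZ : {subset V <= ~: X} by move=> x /VX; rewrite !inE.
have VmaxZ s : ispath s -> {subset s <= ~: X} -> size s <= size V.
  by move=> sp sZ; apply: Vmax => // x /sZ; rewrite !inE.
have k_gt0 : 0 < size V by case: (V) V0.
have cardV : #|[set x in V]| = size V by rewrite cardsE; apply/card_uniqP; case/andP: Vp.
have cardXV : #|X :|: [set x in V]| = #|X| + size V.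
  rewrite cardsU cardV (_ : X :&: _ = set0) ?cards0 ?subn0 //.
  by apply/setP => x; rewrite !inE; apply/negP=> /andP[xX /VX]; rewrite inE xX.
have split_card (P : pred F) : #|[set x in X :|: [set x in V] | P x]| <=
    #|[set x in X | P x]| + #|[set x in V | P x]|.
  rewrite (_ : [set x in _ | P x] = [set x in X | P x] :|: [set x in V | P x]).
    by rewrite cardsU leq_subr.
  by apply/setP => x; rewrite !inE andb_orl.
have outP z : z \notin X :|: [set x in V] -> [/\ z \notin X, z \in ~: X & z \notin V].
  by rewrite !inE negb_or => /andP[].
split=> //; split.
- have [h hV hP] := hub_longest Vp VZ VmaxZ k_gt0.
  exists h => [|y /outP[_ yZ yV]]; last exact: hP.
  by rewrite !inE hV orbT.
- move=> y y' /outP[yX yZ yV] /outP[y'X y'Z y'V] yy'.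
  have := attached_longest Vp VZ VmaxZ yZ yV y'Z y'V yy'.
  have := split_card (fun x => e y x || e y' x); rewrite cardXV /attached.
  case: Xres => [->|[_ /(_ y y' yX y'X yy') + _ _]].
    rewrite cards0 (_ : [set x in set0 | _] = set0) ?cards0; first by clear; lia.
    by apply/setP => x; rewrite !inE.
  by rewrite /attached; clear; lia.
- move=> y y' /outP[yX yZ yV] /outP[y'X y'Z y'V]; rewrite cardXV => tight.
  have := split_card (fun x => e y x || e y' x).
  have [tX|tV] : (reservoir X /\ #|X| <= 2 * #|attached X y y'|) \/
      size V <= 2 * #|[set x in V | e y x || e y' x]|.
  + have := split_card (fun x => e y x || e y' x).
    move: tight; rewrite /attached; case: Xres => [->|resX].
      rewrite cards0 (_ : [set x in set0 | _] = set0) ?cards0; first by right; lia.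
      by apply/setP => x; rewrite !inE.
    have [|lt] := leqP #|X| (2 * #|[set x in X | e y x || e y' x]|); first by left.
    by move: lt; right; lia.
  + case: tX => -[_ _ c3 _] /(c3 _ _ yX y'X)[x [x' [xS x'S xx']]] _.
    exists x, x'; split; last by move=> z /outP[zX _ _]; apply: xx'.
    * by move: xS; rewrite !inE => /andP[-> ->].
    * by move: x'S; rewrite !inE => /andP[-> ->].
  + have [x [x' [xV x'V xS x'S xx']]] := attached_longest_tight Vp VZ VmaxZ yZ yV y'Z y'V k_gt0 tV.
    move=> _; exists x, x'; split; last by move=> z /outP[_ zZ zV]; apply: xx'.
    * by rewrite !inE xV orbT.
    * by rewrite !inE x'V orbT.
- move=> w wp w0 wXV.
  have wX : {subset w <= [predC X]} by move=> x /wXV /outP[]; rewrite inE.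
  have wZ : {subset w <= ~: X} by move=> x /wXV /outP[].
  have wV : {subset w <= [predC V]} by move=> x /wXV /outP[].
  have := attached_path Vp VZ VmaxZ wp wZ wV.
  have := split_card (fun x => has (e x) w); rewrite cardXV.
  case: Xres => [->|[_ _ _ /(_ w wp w0 wX)]].
    rewrite cards0 (_ : [set x in set0 | _] = set0) ?cards0; first by clear; lia.
    by apply/setP => x; rewrite !inE.
  by clear; lia.
Qed.

(** * Embedding the Jahangir graph in the complement *)

Lemma jahangir_of_hall m X h (a : 'I_m -> F) :
  injective a -> (forall i, a i \notin X) -> h \in X -> (forall i, ~~ e h (a i)) ->
  (forall P : {set 'I_m},
     #|P| <= #|\bigcup_(i in P) (X :\ h :\: attached X (a i) (a (ordS i)))|) ->
  contains (compl_graph F) (jahangir_graph m).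
Proof.
move=> ainj aX hX ha /Hall[b binj bD].
have bX i : b i \in X by have := bD i; rewrite !inE => /and3P[].
have bh i : b i != h by have := bD i; rewrite !inE => /and3P[].
have ab i : ~~ e (a i) (b i) /\ ~~ e (a (ordS i)) (b i).
  have := bD i; rewrite /attached !inE bX bh /= andbT negb_or => /andP[].
  by [].
have half_lt (i : 'I_(2 * m)) : i./2 < m by have := ltn_ord i; clear; lia.
pose hf i := Ordinal (half_lt i).
(* Position [2 * i] carries [a i], and position [2 * i + 1] carries [b i], which must avoid the
   neighbors of [a i] and of its cyclic successor. *)
pose g (i : 'I_(2 * m)) := if odd i then b (hf i) else a (hf i).
have neq_XY x y : x \in X -> y \notin X -> x != y by move=> xX; apply: contraNneq => <-.
have step i : compl_edge (g i) (g (ordS i)).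
  have i_lt := ltn_ord i.
  have [io|ie] := boolP (odd i).
  - have hS : hf (ordS i) = ordS (hf i).
      apply: val_inj => /=; have [lt|ge] := ltnP i.+1 (2 * m).
        by rewrite !modn_small //; move: io lt; clear; lia.
      have -> : i.+1 = 2 * m by move: i_lt ge; clear; lia.
      have -> : i./2.+1 = m by move: i_lt ge io; clear; lia.
      by rewrite !modnn.
    have -> : g (ordS i) = a (ordS (hf i)).
      rewrite /g hS ifF //=; apply/negbTE; have [lt|ge] := ltnP i.+1 (2 * m).
        by rewrite modn_small //= io.
      by rewrite (_ : i.+1 = 2 * m) ?modnn //; move: i_lt ge; clear; lia.
    rewrite /g io /compl_edge neq_XY //= edge_sym; exact: (ab (hf i)).2.
  - have lt : i.+1 < 2 * m by move: i_lt ie; clear; lia.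
    have hS : hf (ordS i) = hf i.
      by apply: val_inj; rewrite /= modn_small //; move: ie; clear; lia.
    rewrite /g hS /= modn_small //= ie (negbTE ie) /compl_edge eq_sym neq_XY //=.
    exact: (ab (hf i)).1.
exists (fun v : jahangir_graph m => if v is Some i then g i else h); split.
- have gh i : g i != h.
    by rewrite /g; case: ifP => // _; rewrite eq_sym neq_XY.
  move=> [i|] [j|] //= => [|/eqP|/esym/eqP]; rewrite ?(negbTE (gh _)) //.
  have hfE (u v : 'I_(2 * m)) : odd u = odd v -> hf u = hf v -> u = v.
    move=> ouv [huv]; apply: val_inj => /=.
    by rewrite -(odd_double_half u) -(odd_double_half v) ouv huv.
  rewrite /g; case: ifP => oi; case: ifP => oj eq_g.
  + by congr Some; apply: hfE; [rewrite oi oj | apply: binj].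
  + by have := neq_XY _ _ (bX (hf i)) (aX (hf j)); rewrite eq_g eqxx.
  + by have := neq_XY _ _ (bX (hf j)) (aX (hf i)); rewrite eq_g eqxx.
  + by congr Some; apply: hfE; [rewrite oi oj | apply: ainj].
- have hg (i : 'I_(2 * m)) : ~~ odd i -> compl_edge h (g i).
    by move=> ie; rewrite /g (negbTE ie) /compl_edge neq_XY //=; exact: ha.
  move=> [i|] [j|] //= => [|ie|je]; last 1 first.
  + exact: hg.
  + by rewrite /edge /= /cycle_edge => /andP[_ /orP[] /eqP <-];
      [apply: step | rewrite compl_edge_sym; apply: step].
  + by rewrite compl_edge_sym; apply: hg.
Qed.

(** The hub is itself unattached, so it accounts for the separate [+ 1]. *)
Lemma card_candidates X h y y' : h \in X -> ~~ e h y -> ~~ e h y' ->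
  #|X :\ h :\: attached X y y'| + #|attached X y y'| + 1 = #|X|.
Proof.
move=> hX hy hy'; rewrite [#|X|](cardsD1 h) hX -(cardsID (attached X y y') (X :\ h)).
rewrite (setIidPr _); first by clear; lia.
apply/subsetP => x; rewrite !inE => /andP[-> /orP[]] exy; rewrite andbT.
  by apply: contraNneq hy => <-; rewrite edge_sym.
by apply: contraNneq hy' => <-; rewrite edge_sym.
Qed.

Lemma ordS_neq m (i : 'I_m) : 1 < m -> ordS i != i.
Proof.
move=> m1; rewrite -val_eqE /=; have i_lt := ltn_ord i.
have [lt|ge] := ltnP i.+1 m; first by rewrite modn_small // gtn_eqF.
have im : i.+1 = m by move: i_lt ge; clear; lia.
by rewrite im modnn; move: im m1; clear; lia.
Qed.

(** Each candidate set has at least [m.-1] elements, so Hall's condition can fail only for the full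
    index set, with all candidate sets equal to one set of [m.-1] elements. Their complements in
    [X :\ h] are the attached sets, of size [#|X| - m], at least half of [X]. *)
Lemma jahangir_or_attached_constant m X (a : 'I_m -> F) :
  1 < m -> reservoir X -> 2 * m <= #|X| -> injective a -> (forall i, a i \notin X) ->
  contains (compl_graph F) (jahangir_graph m) \/
  forall i, #|X| <= 2 * #|attached X (a i) (a (ordS i))| /\
    forall j, attached X (a i) (a (ordS i)) = attached X (a j) (a (ordS j)).
Proof.
move=> m1 [[h hX hP] c2 _ _] leX ainj aX.
have ha i : ~~ e h (a i) by apply: hP.
pose S i := attached X (a i) (a (ordS i)); pose D i := X :\ h :\: S i.
have [/forallP hall|] := boolP [forall P : {set 'I_m}, #|P| <= #|\bigcup_(i in P) D i|].
  by left; apply: jahangir_of_hall hX ha hall.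
rewrite negb_forall => /existsP[P]; rewrite -ltnNge => small; right.
have cardD i : #|D i| + #|S i| + 1 = #|X| := card_candidates hX (ha _) (ha _).
have leD i : m.-1 <= #|D i|.
  have neq : a i != a (ordS i) by rewrite (inj_eq ainj) eq_sym ordS_neq.
  by have := c2 _ _ (aX i) (aX (ordS i)) neq; rewrite -/(S i); move: (cardD i) leX; clear; lia.
have [i0 i0P] : exists i, i \in P.
  by apply/set0Pn; rewrite -card_gt0 (leq_ltn_trans _ small).
set U := \bigcup_(i in P) D i in small.
have leP : #|P| <= m by rewrite -[m in _ <= m]card_ord max_card.
have leU : m.-1 <= #|U| by apply: leq_trans (leD i0) _; apply/subset_leq_card/bigcup_sup.
have PT : P = setT.
  by apply/eqP; rewrite eqEcard subsetT cardsT card_ord; move: leU small; clear; lia.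
have DU i : D i = U.
  apply/eqP; rewrite eqEcard bigcup_sup ?PT ?inE //=.
  by apply: leq_trans (leD i); move: small leP; clear; lia.
have SD i : S i = X :\ h :\: D i.
  rewrite setDDr setDv set0U; apply/esym/setIidPr.
  apply/subsetP => x; rewrite !inE => /andP[-> /orP[]] exy; rewrite andbT.
    by apply: contraNneq (ha i) => <-; rewrite edge_sym.
  by apply: contraNneq (ha (ordS i)) => <-; rewrite edge_sym.
move=> j; split; last by move=> j'; rewrite -/(S j) -/(S j') !SD !DU.
by have := cardD j; rewrite DU -/(S j); move: small leP leX; clear; lia.
Qed.

Lemma jahangir_of_large m X : 2 < m -> reservoir X -> 2 * m <= #|X| -> m <= #|~: X| ->
  contains (compl_graph F) (jahangir_graph m).
Proof.
move=> m2 resX leX leC.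
pose a (i : 'I_m) := enum_val (widen_ord leC i).
have ainj : injective a by move=> i j /enum_val_inj [] /val_inj.
have aX i : a i \notin X by have := enum_valP (widen_ord leC i); rewrite inE.
case: m => [|[|[|m]]] // in m2 leX leC a ainj aX *.
have o1 : 1 < m.+3 by []; have o2 : 2 < m.+3 by [].
pose i0 : 'I_m.+3 := ord0; pose i1 := Ordinal o1; pose i2 := Ordinal o2.
have S0 : ordS i0 = i1 by apply: val_inj; rewrite /= modn_small.
have S1 : ordS i1 = i2 by apply: val_inj; rewrite /= modn_small.
have [//|A] := jahangir_or_attached_constant o1 resX leX ainj aX.
(* Reordering the cycle compares the pair [a i0, a i2] with the other two pairs. *)
have [||//|B] := @jahangir_or_attached_constant _ X (a \o tperm i1 i2) o1 resX leX.
- by apply: inj_comp => //; apply: perm_inj.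
- by move=> i; apply: aX.
have [tight /(_ i1)] := A i0; rewrite S0 S1 => A01.
have [_ /(_ i1)] := B i0; rewrite S0 S1 /= tpermL tpermR tpermD // => B02.
rewrite S0 in tight.
have attC y y' : attached X y y' = attached X y' y by apply/setP => x; rewrite !inE orbC.
have [_ _ c3 _] := resX.
have [x [x' [xS x'S xx']]] := c3 _ _ (aX i0) (aX i1) tight.
have := xS; have := x'S; have := xS; have := x'S.
rewrite {1 2}A01 attC -B02 !inE => /andP[_ x'02] /andP[_ x02] /andP[_ x'01] /andP[_ x01].
have := xS; have := x'S; rewrite A01 !inE => /andP[_ x'12] /andP[_ x12].
(* Each of [x] and [x'] is adjacent to at least two of the three vertices, so one of the three is
   adjacent to both. *)
have := xx' _ (aX i0); have := xx' _ (aX i1); have := xx' _ (aX i2).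
move: x'02 x02 x'01 x01 x'12 x12.
by case: (e (a i0) x); case: (e (a i1) x); case: (e (a i2) x) => //=;
  case: (e (a i0) x'); case: (e (a i1) x'); case: (e (a i2) x').
Qed.

Lemma jahangir_of_overshoot m X w : 1 < m -> reservoir X -> #|X| < 2 * m ->
  ispath w -> {subset w <= [predC X]} -> 2 * m < #|X| + size w -> m <= #|~: X| ->
  contains (compl_graph F) (jahangir_graph m).
Proof.
move=> m1 [[h hX hP] c2 _ c4] ltX wp wX ltw leC.
have w0 : w != [::] by case: (w) ltw => //=; move: ltX; clear; lia.
have [x0 _] : exists x, x \in w by case: (w) w0 => // x s _; exists x; rewrite mem_head.
(* Listing [w] first gives the small indices to its vertices. *)
pose s := w ++ [seq x <- enum (~: X) | x \notin w].
have us : uniq s.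
  rewrite cat_uniq filter_uniq ?enum_uniq // andbT; case/andP: wp => -> _ /=.
  by apply/hasPn => x; rewrite mem_filter => /andP[].
have sX x : x \in s -> x \notin X.
  by rewrite mem_cat mem_filter mem_enum inE => /orP[/wX | /andP[]].
have les : m <= size s.
  apply: leq_trans leC _; rewrite cardE; apply: uniq_leq_size (enum_uniq _) _ => x.
  by rewrite mem_enum mem_cat mem_filter => xC; rewrite mem_enum xC andbT; case: (x \in w).
pose a (i : 'I_m) := nth x0 s i.
have a_lt (i : 'I_m) : i < size s by apply: leq_trans les.
have ainj : injective a.
  by move=> i j /eqP; rewrite nth_uniq // => /eqP/val_inj.
have aX i : a i \notin X by apply/sX/mem_nth.
have ha i : ~~ e h (a i) by apply: hP.
have aw (i : 'I_m) : i < size w -> a i \in w by move=> iw; rewrite /a nth_cat iw mem_nth.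
apply: (jahangir_of_hall ainj aX hX ha) => P.
pose D i := X :\ h :\: attached X (a i) (a (ordS i)); rewrite -/(\bigcup_(i in P) D i).
have cardD i : #|D i| + #|attached X (a i) (a (ordS i))| + 1 = #|X| :=
  card_candidates hX (ha _) (ha _).
have leDU i : i \in P -> #|D i| <= #|\bigcup_(i in P) D i|.
  by move=> iP; apply/subset_leq_card/bigcup_sup.
have leP : #|P| <= m by rewrite -[m in _ <= m]card_ord max_card.
(* If both outside neighbors of an odd position lie on [w], the last reservoir clause leaves at
   least [m] candidates; the strict inequality in [ltw] makes the rounding work. *)
have [i /andP[iP /andP[iw jw]]|noP] :=
    pickP (fun i => (i \in P) && ((a i \in w) && (a (ordS i) \in w))).
  apply: leq_trans (leDU i iP); have := c4 w wp w0 wX.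
  have : #|attached X (a i) (a (ordS i))| <= #|[set x in X | has (e x) w]|.
    apply/subset_leq_card/subsetP => x; rewrite !inE => /andP[-> ax] /=; apply/hasP.
    by case/orP: ax => ax; [exists (a i) | exists (a (ordS i))]; rewrite // edge_sym.
  by move: (cardD i) ltw leP; clear; lia.
(* Any index below [(size w).-1] has itself and its cyclic successor sent to [w], also at the
   wrap-around, hence is not in [P]. *)
have leP' : #|P| <= m - (size w).-1.
  rewrite cardE -(size_map val) -(size_iota (size w).-1 (m - (size w).-1)).
  apply: uniq_leq_size => [|j /mapP[i]].
    by rewrite map_inj_uniq ?enum_uniq //; apply: val_inj.
  rewrite mem_enum => iP ->; rewrite -[val i]/(nat_of_ord i) mem_iota; have i_lt := ltn_ord i.
  have [lt|] := ltnP i (size w).-1; last by move: i_lt; clear; lia.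
  have := noP i; rewrite iP aw; last by move: lt; clear; lia.
  rewrite aw //=; have [lt'|ge] := ltnP i.+1 m.
    by rewrite modn_small //; move: lt; clear; lia.
  rewrite (_ : i.+1 = m) ?modnn; first by move: lt; clear; lia.
  by move: i_lt ge; clear; lia.
have [->|[i iP]] := set_0Vmem P; first by rewrite cards0.
apply: leq_trans (leDU i iP); apply: leq_trans leP' _.
have neq : a i != a (ordS i) by rewrite (inj_eq ainj) eq_sym ordS_neq.
have := c2 _ _ (aX i) (aX (ordS i)) neq.
by move: (cardD i) ltw ltX; clear; lia.
Qed.

(** Longest paths are added until [#|X|] hits or would overshoot [2 * m]. Keeping [#|X| <= 2 * m]
    leaves at least [m] vertices outside. *)
Lemma jahangir_of_small m X : 2 < m -> 3 * m <= #|F| -> reservoir X -> #|X| <= 2 * m ->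
  contains (compl_graph F) (jahangir_graph m).
Proof.
move=> m2 leF.
have [n] := ubnP (2 * m - #|X|); elim: n X => // n IHn X ltn resX leX.
have cardC := cardsC X.
have leC : m <= #|~: X| by move: cardC leX leF; clear; lia.
have [ge|ltX] := leqP (2 * m) #|X|; first exact: jahangir_of_large ge leC.
have [V [Vp VX Vmax]] := longest_path_exists (~: X).
have VX' : {subset V <= [predC X]} by move=> x /VX; rewrite inE.
have [le|lt] := leqP (#|X| + size V) (2 * m); last first.
  by apply: jahangir_of_overshoot resX ltX Vp VX' lt leC; apply: ltnW.
have V0 : V != [::].
  have [z zC] : exists z, z \in ~: X.
    by apply/set0Pn; rewrite -card_gt0; apply: leq_trans leC; apply: leq_trans m2.
  have := Vmax [:: z] isT; case: (V) => // H.
  by suff : 1 <= 0 by []; apply: H => x; rewrite inE => /eqP->.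
have Vmax' s : ispath s -> {subset s <= [predC X]} -> size s <= size V.
  by move=> sp sX; apply: Vmax => // x /sX; rewrite !inE.
have [resXV cardXV] := reservoir_longest (or_intror resX) Vp V0 VX' Vmax'.
have V1 : 0 < size V by case: (V) V0.
apply: IHn resXV _; rewrite cardXV //.
by move: ltn le V1 ltX; clear; lia.
Qed.

End Reservoir.

(** A longest path with fewer than [n] vertices leaves at least [m] vertices outside and is the
    first reservoir. *)
Lemma ramsey_path_jahangir m n : 2 < m -> 2 * m + 1 <= n ->
  ramsey_arrow (path_graph n) (jahangir_graph m) (n + m - 1).
Proof.
move=> m2 len F cardF.
have [V [Vp _ Vmax]] := longest_path_exists [set: F].
have [x0 _] : exists x, x \in [set: F].
  by apply/set0Pn; rewrite -card_gt0 cardsT cardF; move: m2 len; clear; lia.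
have [ltV|leV] := ltnP (size V) n; [right | left].
- have V0 : V != [::].
    have := Vmax [:: x0] isT; case: (V) => // H.
    by suff : 1 <= 0 by []; apply: H => x _; rewrite inE.
  have V1 : 0 < size V by case: (V) V0.
  have Vmax' (s : seq F) : ispath s -> {subset s <= [predC (set0 : {set F})]} -> size s <= size V.
    by move=> sp _; apply: Vmax => // x _; rewrite inE.
  have V_out : {subset V <= [predC (set0 : {set F})]} by move=> x _; rewrite !inE.
  have [] := reservoir_longest (or_introl erefl) Vp V0 V_out Vmax'.
  rewrite set0U cards0 add0n => resV cardV; have cardC := cardsC [set x in V].
  have [le|lt] := leqP (2 * m) (size V).
    apply: (jahangir_of_large m2 resV); rewrite ?cardV //.
    by move: cardC ltV cardF; rewrite cardV => <-; clear; lia.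
  apply: (jahangir_of_small m2 _ resV); last by rewrite cardV ltnW.
  (* The bound [2 * m + 1 <= n] amounts to [3 * m <= n + m - 1]. *)
  by rewrite cardF; move: len; clear; lia.
- exists (fun i : 'I_n => nth x0 V i); case/andP: Vp => uV /(sortedP x0) sV.
  have iV (i : 'I_n) : i < size V by apply: leq_trans leV.
  split=> [i j /eqP|i j eij]; first by rewrite nth_uniq // => /eqP/val_inj.
  have : path_edge i j by [].
  by case/orP => /eqP E; [| rewrite edge_sym]; rewrite -E; apply: sV; rewrite E.
Qed.

(** * The lower bound: two disjoint cliques *)

Definition two_cliques_edge (k M : nat) : rel 'I_M :=
  fun x y => (x != y) && ((x < k) == (y < k)).

Lemma two_cliques_sym k M : symmetric (@two_cliques_edge k M).
Proof. by move=> x y; rewrite /two_cliques_edge eq_sym [(x < k) == _]eq_sym. Qed.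

Lemma two_cliques_irrefl k M : irreflexive (@two_cliques_edge k M).
Proof. by move=> x; rewrite /two_cliques_edge eqxx. Qed.

Definition two_cliques k M := SGraph (@two_cliques_sym k M) (@two_cliques_irrefl k M).

Lemma card_inj_interval p M lo hi (f : 'I_p -> 'I_M) :
  injective f -> (forall i, lo <= f i < hi) -> p <= hi - lo.
Proof.
move=> finj fP; rewrite -[p]card_ord cardE -(size_map (val \o f)) -(size_iota lo (hi - lo)).
apply: uniq_leq_size => [|j /mapP[i _ ->]].
  by rewrite map_inj_uniq ?enum_uniq //; apply: inj_comp finj; apply: val_inj.
rewrite mem_iota; move: (fP i) => /=; move: (nat_of_ord (f i)); clear; lia.
Qed.

(** A path is connected, so it lies within one clique. *)
Lemma two_cliques_path k M n : k < n -> M - k < n ->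
  ~ contains (two_cliques k M) (path_graph n).
Proof.
case: n => // n kn Mn [f [finj fe]].
have side (i : 'I_n.+1) : (f i < k) = (f ord0 < k).
  case: i; elim=> [|i IHi] ilt; first by congr (f _ < k); apply: val_inj.
  have := fe (Ordinal (ltnW ilt)) (Ordinal ilt).
  by rewrite /edge /= /path_edge /= eqxx => /(_ isT)/andP[_ /eqP <-].
have [lt|ge] := boolP (f ord0 < k).
  suff : n.+1 <= k - 0 by rewrite subn0 leqNgt kn.
  by apply: card_inj_interval finj _ => i; rewrite side.
have : n.+1 <= M - k.
  apply: card_inj_interval finj _ => i.
  by rewrite leqNgt side ge ltn_ord.
by rewrite leqNgt Mn.
Qed.

(** The complement is complete bipartite. Whichever side holds the hub, either the [m] even or the
    [m] odd cycle vertices all fall into the side of size [M - k]. *)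
Lemma two_cliques_jahangir k M m : M - k < m ->
  ~ contains (compl_graph (two_cliques k M)) (jahangir_graph m).
Proof.
move=> Mm [f [finj fe]].
have cross x y : edge x y -> (f x < k) = ~~ (f y < k).
  move=> /fe/andP[neq]; rewrite /edge /= /two_cliques_edge neq /=.
  by case: (f x < k); case: (f y < k).
have even_lt (i : 'I_m) : i.*2 < 2 * m by have := ltn_ord i; clear; lia.
have odd_lt (i : 'I_m) : i.*2.+1 < 2 * m by have := ltn_ord i; clear; lia.
pose ev i : jahangir_graph m := Some (Ordinal (even_lt i)).
pose od i : jahangir_graph m := Some (Ordinal (odd_lt i)).
have evE i : (f (ev i) < k) = ~~ (f None < k).
  by apply: cross; rewrite /edge /= odd_double.
have odE i : (f (od i) < k) = (f None < k).
  rewrite -[RHS]negbK -(evE i); apply: cross; rewrite /edge /= /cycle_edge.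
  by rewrite -!val_eqE /= orbC modn_small ?odd_lt // eqxx gtn_eqF.
have bound (g : 'I_m -> jahangir_graph m) : injective g ->
    (forall i, (f (g i) < k) = false) -> False.
  move=> ginj gk; have : m <= M - k.
    apply: (card_inj_interval (f := f \o g)) => [|i]; first exact: inj_comp.
    by rewrite /= leqNgt gk ltn_ord.
  by rewrite leqNgt Mm.
have [h|h] := boolP (f None < k).
  apply: (bound ev) => [i j [] /double_inj/val_inj //|i].
  by rewrite evE h.
apply: (bound od) => [i j [] /double_inj/val_inj //|i].
by rewrite odE (negbTE h).
Qed.

Theorem theorem1 (m n : nat) (hm : m \in [:: 3; 4; 5]) (hn : 2 * m + 1 <= n) :
  is_ramsey_number (path_graph n) (jahangir_graph m) (n + m - 1).
Proof.
have m2 : 2 < m by move: hm; rewrite !inE => /or3P[] /eqP->.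
split; first exact: ramsey_path_jahangir.
move=> M arrow; rewrite leqNgt; apply/negP => ltM.
(* The first clique takes up to [n.-1] vertices, so the same construction serves for every [M] below
   [n + m - 1]. *)
have Mm : M - n.-1 < m by move: hn ltM m2; clear; lia.
have [] := arrow (two_cliques n.-1 M) (card_ord M).
  by apply: two_cliques_path; move: hn ltM m2; clear; lia.
exact: two_cliques_jahangir.
Qed.
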